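(* Assume $\diamondsuit$. Then for every function $f:\mathbb{N}\to\mathbb{N}$ there is a Hajnal–Máté graph $G$ such that $|G|=\chi(G)=\aleph_1$ and, for every natural number $k\ge 3$, $f_G(k)\ge f(k)$; that is, every subgraph of $G$ with fewer than $f(k)$ vertices has chromatic number less than $k$.
   Context: $\diamondsuit$ is the assertion that there is a sequence $\langle A_\alpha\mid\alpha<\omega_1\rangle$ with $A_\alpha\subseteq\alpha$ for each $\alpha$ such that for every $A\subseteq\omega_1$ the set $\{\alpha<\omega_1\mid A\cap\alpha=A_\alpha\}$ is stationary. A graph $G=(\omega_1,E)$ is a Hajnal–Máté graph if for every $\beta<\omega_1$ the set $\{\alpha<\beta\mid \{\alpha,\beta\}\in E\}$ is either finite or a set of order type $\omega$ converging to $\beta$ (i.e., cofinal in $\beta$). Graphs are simple undirected graphs. For a graph $G$ with infinite chromatic number and $k\in\mathbb{N}$, $f_G(k)$ is the least natural number $m$ such that $G$ has a subgraph with $m$ vertices and chromatic number at least $k$. *)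

(* Defs.v *)
(* omega_1 is represented abstractly as any strict well-order
   (T, lt) that is uncountable and all of whose proper initial segments are
   countable; this characterizes the order type omega_1 up to isomorphism. *)
From Stdlib Require Import List Arith Classical.

Section Omega1.
Context {T : Type} (lt : T -> T -> Prop).

Definition le (x y : T) : Prop := lt x y \/ x = y.

Definition is_omega1 : Prop :=
  (forall x, ~ lt x x) /\
  (forall x y z, lt x y -> lt y z -> lt x z) /\
  (forall x y, lt x y \/ x = y \/ lt y x) /\
  well_founded lt /\
  (~ exists g : T -> nat, forall x y, g x = g y -> x = y) /\
  (forall b : T, exists g : T -> nat,
      forall x y, lt x b -> lt y b -> g x = g y -> x = y).

Definition unbounded (C : T -> Prop) : Prop :=
  forall g, exists a, lt g a /\ C a.

Definition closed (C : T -> Prop) : Prop :=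
  forall b, (exists g, lt g b) ->
    (forall g, lt g b -> exists a, lt g a /\ lt a b /\ C a) -> C b.

Definition club (C : T -> Prop) : Prop := closed C /\ unbounded C.

Definition stationary (S : T -> Prop) : Prop :=
  forall C, club C -> exists a, C a /\ S a.

Definition diamond : Prop :=
  exists A : T -> T -> Prop,
    (forall a x, A a x -> lt x a) /\
    forall X : T -> Prop,
      stationary (fun a => forall x, lt x a -> (X x <-> A a x)).

Definition finite_set (P : T -> Prop) : Prop :=
  exists l : list T, forall x, P x -> In x l.

Definition order_type_omega_converging (P : T -> Prop) (b : T) : Prop :=
  (forall x, P x -> lt x b) /\
  ~ finite_set P /\
  (forall x, P x -> finite_set (fun y => P y /\ lt y x)) /\
  (forall g, lt g b -> exists a, P a /\ lt g a).

Definition simple_graph (E : T -> T -> Prop) : Prop :=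
  (forall x, ~ E x x) /\ (forall x y, E x y -> E y x).

Definition hajnal_mate (E : T -> T -> Prop) : Prop :=
  simple_graph E /\
  forall b, let N := fun a => lt a b /\ E a b in
    finite_set N \/ order_type_omega_converging N b.

(* chi(G) = aleph_1 for a graph on omega_1: not countably colourable
   (chi(G) <= |G| = aleph_1 always holds). *)
Definition chromatic_aleph1 (E : T -> T -> Prop) : Prop :=
  ~ exists c : T -> nat, forall x y, E x y -> c x <> c y.

Definition colorable_on (E : T -> T -> Prop) (S : list T) (m : nat) : Prop :=
  exists c : T -> nat,
    (forall x, In x S -> c x < m) /\
    (forall x y, In x S -> In y S -> E x y -> c x <> c y).

End Omega1.

(* Main.v *)
(** The edges are split into types: a vertex has at most one smaller neighbour
    of each type, so the edges of type [< j] span a graph of chromatic number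
    at most [j + 1].  Every vertex [b] carries an increasing sequence [t b], and
    an edge of type [n] must interleave the sequences of its ends, as in Specker
    graphs, with shift [s j] inside the [j]-th window for every [j <= n].  Hence
    edges of type [>= j] contain no odd closed walk of length [< s j], and sets
    of at most [s j / 2] vertices are [2 (j + 1)]-colourable; [s] is arbitrary.

    Diamond guesses a colouring [c] together with a club [D].  If [b] guesses
    correctly, [t b] is a sequence in [D] cofinal in [b], and the type-[n]
    neighbour of [b] is sought in colour [n].  When [D] consists of reflection
    points of [c], the vertex [b], of colour [n] say, and its sequence reflect
    downwards: the entries of a sequence [t a] with [c a = n] can be put one
    after the other in prescribed intervals of [t b], so [b] has a neighbour of
    its own colour.  The edges at [b] depend only on [t] and on the guess, so
    no recursion is needed. *)
Require Import Defs.
From Stdlib Require Import List Arith Lia Classical ClassicalEpsilon.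
From Stdlib Require Import FunctionalExtensionality PropExtensionality Cantor.
Import ListNotations.

(** * Choice principles and recursion along a well-order *)

Lemma functional_choice {A B : Type} (R : A -> B -> Prop) :
  (forall x, exists y, R x y) -> exists f, forall x, R x (f x).
Proof.
  intros H.
  exists (fun x => proj1_sig (constructive_indefinite_description _ (H x))).
  intros x. exact (proj2_sig (constructive_indefinite_description _ (H x))).
Qed.

Lemma least_nat (P : nat -> Prop) :
  (exists n, P n) -> exists n, P n /\ forall m, P m -> n <= m.
Proof.
  intros [n Hn]. revert Hn. induction n as [n IH] using (well_founded_induction lt_wf).
  intros Hn. destruct (classic (exists m, m < n /\ P m)) as [[m [Hm HP]]|H].
  - exact (IH m Hm HP).
  - exists n; split; [exact Hn|]. intros m Hm.
    destruct (le_lt_dec n m); [assumption|]. exfalso; eauto.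
Qed.

(** Well-founded recursion with a chosen value at each point. The default that [ext_of] gives
    outside the initial segment is harmless, because the third premise makes [P a] depend on the
    function below [a] only. *)
Lemma well_founded_choice {A B : Type} (lt : A -> A -> Prop)
    (P : A -> (A -> B) -> B -> Prop) :
  well_founded lt -> inhabited B ->
  (forall a g g' v, (forall y, lt y a -> g y = g' y) -> P a g v -> P a g' v) ->
  (forall a g, exists v, P a g v) ->
  exists f, forall a, P a f (f a).
Proof.
  intros wf iB ext ex.
  set (ext_of := fun (a : A) (r : forall y, lt y a -> B) (y : A) =>
    match excluded_middle_informative (lt y a) with
    | left h => r y h
    | right _ => epsilon iB (fun _ => True)
    end).
  set (F := fun a r => epsilon iB (P a (ext_of a r))).
  exists (Fix wf (fun _ => B) F). intros a.
  rewrite Fix_eq.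
  - unfold F at 2.
    assert (H := epsilon_spec iB _ (ex a (ext_of a (fun y _ => Fix wf (fun _ => B) F y)))).
    revert H. apply ext. intros y Hy. unfold ext_of.
    destruct (excluded_middle_informative (lt y a)); [reflexivity|contradiction].
  - intros x f g H. f_equal.
    apply functional_extensionality_dep; intros y.
    apply functional_extensionality_dep; intros h. apply H.
Qed.

(** * Short odd closed walks *)

Inductive walk {V : Type} (E : V -> V -> Prop) : nat -> V -> V -> Prop :=
| walk_nil x : walk E 0 x x
| walk_snoc n x y z : walk E n x y -> E y z -> walk E (S n) x z.

Lemma walk_app {V} (E : V -> V -> Prop) m n x y z :
  walk E m x y -> walk E n y z -> walk E (m + n) x z.
Proof.
  intros H1 H2. revert H1. induction H2 as [y|n y u z H2 IH HE]; intros H1.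
  - now rewrite Nat.add_0_r.
  - rewrite Nat.add_succ_r. econstructor; eauto.
Qed.

Lemma walk_sym {V} (E : V -> V -> Prop) n x y :
  (forall x y, E x y -> E y x) -> walk E n x y -> walk E n y x.
Proof.
  intros sym H. induction H as [x|n x y z H IH HE].
  - constructor.
  - change (S n) with (1 + n). eapply walk_app; [|exact IH].
    econstructor; [constructor|auto].
Qed.

Lemma walk_mono {V} (E E' : V -> V -> Prop) n x y :
  (forall x y, E x y -> E' x y) -> walk E n x y -> walk E' n x y.
Proof. intros H W. induction W; econstructor; eauto. Qed.

(* Colour by the parity of the distance to a root of the component: the
   vertices on a geodesic are distinct, so distances are below the order. *)
Lemma bipartite_of_no_short_odd_closed_walk {V : Type} (E : V -> V -> Prop) (S : list V) :
  (forall x y, E x y -> E y x) ->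
  (forall x n, Nat.odd n = true -> n < 2 * length S -> ~ walk E n x x) ->
  exists c : V -> bool, forall x y, In x S -> In y S -> E x y -> c x <> c y.
Proof.
  intros symE Hodd.
  destruct (classic (inhabited V)) as [iV|nV];
    [|exists (fun _ => true); intros x; exfalso; apply nV; now constructor].
  set (E' := fun x y => In x S /\ In y S /\ E x y).
  assert (sym : forall x y, E' x y -> E' y x) by (unfold E'; intuition).
  set (conn := fun x y => exists n, walk E' n x y).
  (* Connected vertices have extensionally equal predicates [conn], so [epsilon] gives them the same
     root. *)
  set (root := fun x => epsilon iV (conn x)).
  assert (connE : forall x y, E' x y -> root x = root y).
  { intros x y H. unfold root. f_equal. apply functional_extensionality; intros z.
    assert (Hxy : walk E' 1 x y) by (econstructor; [constructor|exact H]).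
    apply propositional_extensionality; split; intros [n W]; eexists; eapply walk_app;
      [apply (walk_sym _ _ _ _ sym Hxy)|exact W|exact Hxy|exact W]. }
  assert (rootC : forall x, exists n, walk E' n (root x) x).
  { intros x. destruct (epsilon_spec iV (conn x)) as [n W];
      [exists x, 0; constructor|]. exists n. now apply walk_sym. }
  destruct (functional_choice (fun x n => walk E' n (root x) x /\
      forall m, walk E' m (root x) x -> n <= m)) as [d Hd].
  { intros x. apply (least_nat (fun n => walk E' n (root x) x)), rootC. }
  assert (geo : forall n x, d x = n -> In x S -> exists l, NoDup l /\ incl l S /\
      length l = Datatypes.S n /\ forall y, In y l -> d y <= n).
  { induction n as [|n IH]; intros x Hx xS.
    - exists [x]. repeat split.
      + constructor; [easy|constructor].
      + intros y [<-|[]]; assumption.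
      + intros y [<-|[]]; lia.
    - destruct (Hd x) as [W Hmin]. rewrite Hx in W.
      inversion W as [|n' r y z W' HE]; subst.
      assert (Hr := connE _ _ HE). destruct (Hd y) as [Wy My]. rewrite Hr in Wy, My.
      assert (d y <= n) by now apply My.
      assert (d x <= Datatypes.S (d y)) by (apply Hmin; econstructor; eassumption).
      destruct (IH y) as (l & L1 & L2 & L3 & L4); [lia|apply HE|].
      exists (x :: l). repeat split.
      + constructor; [|assumption]. intros Hin. specialize (L4 _ Hin). lia.
      + intros u [<-|Hu]; auto.
      + simpl; lia.
      + intros u [<-|Hu]; [lia|]. specialize (L4 _ Hu). lia. }
  assert (short : forall x, In x S -> d x < length S).
  { intros x xS. destruct (geo _ x eq_refl xS) as (l & L1 & L2 & L3 & _).
    assert (H := NoDup_incl_length L1 L2). lia. }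
  exists (fun x => Nat.odd (d x)). intros x y xS yS HE Hc.
  assert (HE' : E' x y) by (split; auto).
  destruct (Hd x) as [Wx _], (Hd y) as [Wy _]. rewrite <- (connE _ _ HE') in Wy.
  (* Go from the root to [x], along the edge, and back from [y]. Equal parities make the length odd,
     and both distances are below [length S]. *)
  assert (W : walk E' (d x + (1 + d y)) (root x) (root x)).
  { eapply walk_app; [exact Wx|]. eapply walk_app.
    - econstructor; [constructor|exact HE'].
    - now apply walk_sym. }
  apply (Hodd (root x) (d x + (1 + d y))).
  - rewrite !Nat.odd_add, Hc. now destruct (Nat.odd (d y)).
  - generalize (short x xS) (short y yS). lia.
  - revert W. apply walk_mono. unfold E'; intuition.
Qed.

(** * Closed walks along interleaved sequences *)

Section Interleaving.
Context {T : Type} (lt : T -> T -> Prop).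
Hypothesis lt_irrefl : forall x, ~ lt x x.
Hypothesis lt_trans : forall x y z, lt x y -> lt y z -> lt x z.
Context {V : Type} (t : V -> nat -> T).
Hypothesis t_incr : forall v i j, i < j -> lt (t v i) (t v j).

Definition interleaved (s b e : nat) (x y : V) : Prop :=
  forall i, b <= i -> i + s + 1 < e ->
    lt (t x (i + s)) (t y i) /\ lt (t y i) (t x (i + s + 1)).

Lemma le_lt_trans x y z : le lt x y -> lt y z -> lt x z.
Proof. intros [H|<-]; eauto. Qed.

Lemma lt_le_trans x y z : lt x y -> le lt y z -> lt x z.
Proof. intros H [H'|<-]; eauto. Qed.

(* A step along the order shifts indices by s + 1/2 up to an error 1/2, and a
   step against it by the opposite amount; the errors add up. *)
Lemma interleaved_walk s b e n x z :
  walk (fun u v => interleaved s b e u v \/ interleaved s b e v u) n x z ->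
  (* [p] counts the steps along the order and [q] those against it. Solving for [u] and [v] by
     equations avoids truncated subtraction. *)
  exists p q, p + q = n /\
    forall i, b + (s + 1) * n <= i -> i + (s + 1) * n + 1 < e ->
      (forall u, i + s * p = u + (s + 1) * q -> le lt (t x u) (t z i)) /\
      (forall v, i + (s + 1) * p = v + s * q -> le lt (t z i) (t x v)).
Proof.
  intros W. induction W as [x|n x y z W (p & q & Hpq & IH) [HI|HI]].
  - exists 0, 0. split; [reflexivity|]. intros i _ _.
    split; intros u Hu; right; f_equal; lia.
  - exists (S p), q. split; [lia|]. intros i H1 H2.
    destruct (HI i) as [L R]; [lia|lia|].
    split; intros u Hu; left.
    + destruct (IH (i + s)) as [IL _]; [lia|lia|].
      eapply le_lt_trans; [apply IL; lia|exact L].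
    + destruct (IH (i + s + 1)) as [_ IR]; [lia|lia|].
      eapply lt_le_trans; [exact R|apply IR; lia].
  - exists p, (S q). split; [lia|]. intros i H1 H2.
    split; intros u Hu; left.
    + destruct (IH (i - s - 1)) as [IL _]; [lia|lia|].
      destruct (HI (i - s - 1)) as [_ R]; [lia|lia|].
      replace (i - s - 1 + s + 1) with i in R by lia.
      eapply le_lt_trans; [apply IL; lia|exact R].
    + destruct (IH (i - s)) as [_ IR]; [lia|lia|].
      destruct (HI (i - s)) as [L _]; [lia|lia|].
      replace (i - s + s) with i in L by lia.
      eapply lt_le_trans; [exact L|apply IR; lia].
Qed.

(** In an odd closed walk [p] and [q] differ. The drift, at least [s], then outweighs the
    accumulated error, at most [n], so an entry of the increasing sequence [t x] would be bounded by
    an earlier one. The length of the window keeps all indices inside it. *)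
Lemma interleaved_no_short_odd_closed_walk s b e n x :
  Nat.odd n = true -> n < s -> b + 3 * (s + 1) * (s + 1) <= e ->
  ~ walk (fun u v => interleaved s b e u v \/ interleaved s b e v u) n x x.
Proof.
  intros Ho Hn He W. destruct (interleaved_walk _ _ _ _ _ _ W) as (p & q & Hpq & H).
  assert (contra : forall i j, i < j -> ~ le lt (t x j) (t x i)).
  { intros i j Hij Hle. apply (lt_irrefl (t x i)).
    eapply lt_le_trans; [apply t_incr, Hij|exact Hle]. }
  destruct (H (b + (s + 1) * n)) as [HL HR]; [lia|nia|].
  assert (p <> q).
  { intros ->. rewrite <- Hpq, Nat.odd_add in Ho. now destruct (Nat.odd q). }
  destruct (le_lt_dec q p).
  - apply (contra (b + (s + 1) * n) (b + (s + 1) * n + s * p - (s + 1) * q)); [nia|].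
    apply HL. nia.
  - apply (contra (b + (s + 1) * n + (s + 1) * p - s * q) (b + (s + 1) * n)); [nia|].
    apply HR. nia.
Qed.

End Interleaving.

(** * Countable sets and clubs in the first uncountable ordinal *)

Fixpoint list_code (l : list nat) : nat :=
  match l with
  | [] => 0
  | a :: l => S (Cantor.to_nat (a, list_code l))
  end.

Lemma list_code_inj l l' : list_code l = list_code l' -> l = l'.
Proof.
  revert l'. induction l as [|a l IH]; intros [|a' l'] H; try easy.
  apply Nat.succ_inj, Cantor.to_nat_inj in H. injection H as -> H. f_equal; auto.
Qed.

Lemma map_inj_on {A B} (P : A -> Prop) (g : A -> B) (l l' : list A) :
  (forall x y, P x -> P y -> g x = g y -> x = y) ->
  Forall P l -> Forall P l' -> map g l = map g l' -> l = l'.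
Proof.
  intros inj Hl. revert l'. induction Hl as [|x l Hx Hl IH]; intros [|x' l'] Hl' H; try easy.
  injection H as H1 H2. inversion Hl'; subst. f_equal; auto.
Qed.

Section OmegaOne.
Context {T : Type} (lt : T -> T -> Prop).
Hypothesis omega1 : is_omega1 lt.

Let lt_irrefl : forall x, ~ lt x x := proj1 omega1.
Let lt_trans : forall x y z, lt x y -> lt y z -> lt x z := proj1 (proj2 omega1).
Let lt_total : forall x y, lt x y \/ x = y \/ lt y x := proj1 (proj2 (proj2 omega1)).
Let lt_wf : well_founded lt := proj1 (proj2 (proj2 (proj2 omega1))).

Lemma not_lt_le x y : ~ lt x y -> le lt y x.
Proof. unfold le. destruct (lt_total x y) as [H|[->|H]]; tauto. Qed.

Lemma omega1_inhabited : inhabited T.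
Proof.
  apply NNPP. intros H. pose proof omega1 as (_ & _ & _ & _ & U & _). apply U.
  exists (fun _ => 0). intros x. exfalso. apply H. now constructor.
Qed.

(** Otherwise each [x] lies in the initial segment closed by some [u n]. Pairing [n] with a code of
    [x] there, [0] being kept for [u n] itself, would inject [T] into [nat]. *)
Lemma sequence_bounded (u : nat -> T) : exists b, forall n, lt (u n) b.
Proof.
  apply NNPP. intros H. pose proof omega1 as (_ & _ & _ & _ & U & C). apply U.
  destruct (functional_choice _ C) as [g Hg].
  destruct (functional_choice (fun x n => le lt x (u n))) as [N HN].
  { intros x. apply NNPP. intros Hx. apply H. exists x. intros n.
    apply NNPP. intros Hn. apply Hx. exists n. now apply not_lt_le. }
  exists (fun x => Cantor.to_nat (N x,
    if excluded_middle_informative (x = u (N x)) then 0 else S (g (u (N x)) x))).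
  intros x y Hxy. apply Cantor.to_nat_inj in Hxy. injection Hxy as H1 H2. rewrite <- H1 in H2.
  destruct (excluded_middle_informative (x = u (N x))),
    (excluded_middle_informative (y = u (N x))); try congruence.
  apply (Hg (u (N x))).
  - destruct (HN x); [assumption|contradiction].
  - specialize (HN y). rewrite <- H1 in HN. destruct HN; [assumption|contradiction].
  - now injection H2.
Qed.

Lemma countable_family_bounded {I : Type} (P : I -> Prop) (code : I -> nat) (F : I -> T) :
  (forall i j, P i -> P j -> code i = code j -> i = j) ->
  exists b, forall i, P i -> lt (F i) b.
Proof.
  intros inj.
  set (u := fun n => epsilon omega1_inhabited (fun x => exists i, P i /\ code i = n /\ F i = x)).
  destruct (sequence_bounded u) as [b Hb]. exists b. intros i Hi.
  assert (Hu : u (code i) = F i).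
  { destruct (epsilon_spec omega1_inhabited
      (fun x => exists j, P j /\ code j = code i /\ F j = x)) as (j & Hj & E1 & E2);
      [now exists (F i), i|].
    unfold u. rewrite <- E2. f_equal. now apply inj. }
  rewrite <- Hu. apply Hb.
Qed.

Lemma exists_gt x : exists y, lt x y.
Proof. destruct (sequence_bounded (fun _ => x)) as [b Hb]. exists b. exact (Hb 0). Qed.

Lemma minimal (P : T -> Prop) : (exists x, P x) -> exists x, P x /\ forall y, lt y x -> ~ P y.
Proof.
  intros [x Hx]. revert Hx. induction x as [x IH] using (well_founded_induction lt_wf).
  intros Hx. destruct (classic (exists y, lt y x /\ P y)) as [[y [H1 H2]]|H]; [eauto|].
  exists x. split; [assumption|]. intros y H1 H2. eauto.
Qed.

Lemma increasing_of_step (u : nat -> T) :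
  (forall n, lt (u n) (u (S n))) -> forall i j, i < j -> lt (u i) (u j).
Proof. intros H i j Hij. induction Hij; eauto. Qed.

Lemma list_below_max b l : (exists g, lt g b) -> Forall (fun x => lt x b) l ->
  exists m, lt m b /\ Forall (fun x => le lt x m) l.
Proof.
  intros Hb Hl. induction Hl as [|x l Hx Hl (m & Hm & IH)].
  - destruct Hb as [g Hg]. exists g. auto.
  - destruct (lt_total x m) as [H|H].
    + exists m. split; [assumption|]. constructor; [now left|assumption].
    + assert (le lt m x) by (destruct H; [right; congruence|now left]).
      exists x. split; [assumption|]. constructor; [now right|].
      revert IH. apply Forall_impl. intros y [Hy|Hy]; [left|now subst].
      eapply lt_le_trans; eauto.
Qed.

Lemma closure_points_club (phi : T -> T) :
  club lt (fun d => (exists g, lt g d) /\ forall x, lt x d -> lt (phi x) d).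
Proof.
  split.
  - intros b Hb Hlim. split; [assumption|]. intros x Hx.
    destruct (Hlim x Hx) as (a & H1 & H2 & _ & H3). eauto.
  - intros g.
    assert (step : exists st : T -> T, forall x,
        lt x (st x) /\ forall y, le lt y x -> lt (phi y) (st x)).
    { apply (functional_choice (fun x v =>
        lt x v /\ forall y, le lt y x -> lt (phi y) v)).
      intros x. destruct (exists_gt x) as [x' Hx'].
      pose proof omega1 as (_ & _ & _ & _ & _ & C). destruct (C x') as [code Hcode].
      destruct (countable_family_bounded (fun y => lt y x') code phi) as [b Hb]; [exact Hcode|].
      (* A family of two members, to bound [b] and [x] at once. *)
      destruct (countable_family_bounded (fun i => i < 2) (fun i => i)
        (fun i => match i with 0 => b | _ => x end)) as [v Hv]; [auto|].
      exists v. split; [apply (Hv 1); lia|]. intros y Hy.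
      apply lt_trans with b; [apply Hb; now apply (le_lt_trans _ lt_trans _ x)|apply (Hv 0); lia]. }
    destruct step as [st Hst].
    set (u := fix u n := match n with 0 => st g | S n => st (u n) end).
    (* [d] is the supremum of the iterates of [st]: each [x] below it is at most some [u n], whence
       [phi x] is below [u (S n)]. *)
    destruct (minimal (fun d => forall n, lt (u n) d) (sequence_bounded u)) as (d & Hd & Hmin).
    exists d. split; [|split].
    + apply lt_trans with (u 0); [apply Hst|apply Hd].
    + exists (u 0). apply Hd.
    + intros x Hx.
      assert (exists n, le lt x (u n)) as [n Hn].
      { apply NNPP. intros H. apply (Hmin x Hx). intros n. apply NNPP. intros Hn.
        apply H. exists n. now apply not_lt_le. }
      apply lt_trans with (u (S n)); [apply Hst, Hn|apply Hd].
Qed.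

(* A poor man's elementary submodel: [d] is closed under witnesses for
   countably many formulas with parameters below [d]. *)
Definition reflects (Phi : bool -> nat -> list T -> T -> Prop) (d : T) : Prop :=
  (exists g, lt g d) /\
  forall k n l, Forall (fun x => lt x d) l ->
    (exists x, Phi k n l x) -> exists x, lt x d /\ Phi k n l x.

(** [F] is a Skolem function. Only countably many tuples have all parameters at most [m], so [phi m]
    can bound their witnesses, and the closure points of [phi] reflect. *)
Lemma reflects_club (Phi : bool -> nat -> list T -> T -> Prop) :
  exists D, club lt D /\ forall d, D d -> reflects Phi d.
Proof.
  set (F := fun i : bool * nat * list T =>
    epsilon omega1_inhabited (Phi (fst (fst i)) (snd (fst i)) (snd i))).
  destruct (functional_choice (fun m b => forall i, Forall (fun x => le lt x m) (snd i) ->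
      lt (F i) b)) as [phi Hphi].
  { intros m. destruct (exists_gt m) as [m' Hm'].
    pose proof omega1 as (_ & _ & _ & _ & _ & C). destruct (C m') as [code Hcode].
    destruct (countable_family_bounded
      (fun i : bool * nat * list T => Forall (fun x => lt x m') (snd i))
      (fun i => Cantor.to_nat (Nat.b2n (fst (fst i)),
        Cantor.to_nat (snd (fst i), list_code (map code (snd i))))) F) as [b Hb].
    - intros [[k n] l] [[k' n'] l'] Hl Hl' H. cbn [fst snd] in *.
      apply Cantor.to_nat_inj, pair_equal_spec in H as [H1 H].
      apply Cantor.to_nat_inj, pair_equal_spec in H as [-> H].
      apply list_code_inj in H.
      assert (k = k') by (destruct k, k'; easy). subst.
      rewrite (map_inj_on _ _ _ _ Hcode Hl Hl' H). reflexivity.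
    - exists b. intros i Hi. apply Hb. revert Hi. apply Forall_impl.
      intros y Hy. eapply le_lt_trans; eauto. }
  exists (fun d => (exists g, lt g d) /\ forall x, lt x d -> lt (phi x) d).
  split; [apply closure_points_club|].
  intros d [Hne Hd]. split; [assumption|]. intros k n l Hl Hex.
  destruct (list_below_max d l Hne Hl) as (m & Hm & Hlm).
  exists (F (k, n, l)). split.
  - apply lt_trans with (phi m); [apply Hphi, Hlm|apply Hd, Hm].
  - exact (epsilon_spec omega1_inhabited _ Hex).
Qed.

Lemma cofinal_sequence (b : T) (D : T -> Prop) :
  (exists g, lt g b) ->
  (forall g, lt g b -> exists x, lt g x /\ lt x b /\ D x) ->
  exists y : nat -> T, (forall i j, i < j -> lt (y i) (y j)) /\
    (forall i, lt (y i) b /\ D (y i)) /\ forall g, lt g b -> exists i, lt g (y i).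
Proof.
  intros [g0 Hg0] HD.
  pose proof omega1 as (_ & _ & _ & _ & _ & C). destruct (C b) as [code Hcode].
  (* [st (x, n)] passes both [x] and the point below [b] with code [n], if there is one. Running
     through all [n] makes the sequence cofinal. *)
  destruct (functional_choice (fun (p : T * nat) x => lt (fst p) b ->
      lt (fst p) x /\ lt x b /\ D x /\
      forall z, lt z b -> code z = snd p -> lt z x)) as [st Hst].
  { intros [x n]. destruct (classic (lt x b)) as [Hx|Hx]; [|exists b; intros; contradiction].
    destruct (classic (exists z, lt z b /\ code z = n)) as [(z & Hz & Ez)|Hn].
    - destruct (list_below_max b [x; z]) as (m & Hm & Hl); [eauto|auto|].
      inversion Hl as [|? ? L1 L2]; subst. inversion L2 as [|? ? L3 _]; subst.
      destruct (HD m Hm) as (v & V1 & V2 & V3). exists v. intros _. simpl.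
      split; [eapply le_lt_trans; eauto|]. repeat split; auto.
      intros z' Hz' E. rewrite (Hcode z' z Hz' Hz E). eapply le_lt_trans; eauto.
    - destruct (HD x Hx) as (v & V1 & V2 & V3). exists v. intros _. simpl.
      repeat split; auto. intros z Hz E. exfalso; eauto. }
  set (y := fix y n := match n with 0 => st (g0, 0) | S n => st (y n, S n) end).
  assert (Hst' : forall x n, lt x b -> lt x (st (x, n)) /\ lt (st (x, n)) b /\
      D (st (x, n)) /\ forall z, lt z b -> code z = n -> lt z (st (x, n)))
    by (intros x n; exact (Hst (x, n))).
  assert (Hy : forall n, lt (y n) b).
  { induction n as [|n IH]; [apply (Hst' g0 0 Hg0)|apply (Hst' _ (S n) IH)]. }
  exists y. split; [|split].
  - apply increasing_of_step. intros n. exact (proj1 (Hst' _ (S n) (Hy n))).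
  - intros n. split; [apply Hy|].
    destruct n as [|n]; [apply (Hst' g0 0 Hg0)|apply (Hst' _ (S n) (Hy n))].
  - intros g Hg. exists (code g). destruct (code g) as [|n] eqn:E.
    + now apply (Hst' g0 0 Hg0).
    + now apply (Hst' _ (S n) (Hy n)).
Qed.

(** A substitute for the ordinals $\omega\cdot x+k$: the block of [x] starts at [h x], above all
    blocks of smaller points. *)
Lemma pairing : exists pr : T -> nat -> T,
  forall x k x' k', pr x k = pr x' k' -> x = x' /\ k = k'.
Proof.
  destruct (functional_choice _ exists_gt) as [st Hst].
  destruct (well_founded_choice lt (fun x (h : T -> T) v =>
      forall y k, lt y x -> lt (Nat.iter k st (h y)) v)) as [h Hh].
  - exact lt_wf.
  - exact omega1_inhabited.
  - intros a g g' v Hg H y k Hy. rewrite <- (Hg y Hy). auto.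
  - intros a g. pose proof omega1 as (_ & _ & _ & _ & _ & C). destruct (C a) as [code Hcode].
    destruct (countable_family_bounded (fun p : T * nat => lt (fst p) a)
      (fun p => Cantor.to_nat (code (fst p), snd p))
      (fun p => Nat.iter (snd p) st (g (fst p)))) as [v Hv].
    + intros [x k] [x' k'] Hx Hx' H. cbn [fst snd] in *. apply Cantor.to_nat_inj in H.
      injection H as H ->. f_equal. auto.
    + exists v. intros y k Hy. exact (Hv (y, k) Hy).
  - exists (fun x k => Nat.iter k st (h x)).
    assert (incr : forall x i j, i < j -> lt (Nat.iter i st (h x)) (Nat.iter j st (h x))).
    { intros x. apply (increasing_of_step (fun k => Nat.iter k st (h x))).
      intros n. apply Hst. }
    assert (incr' : forall x k x' k', lt x x' ->
        lt (Nat.iter k st (h x)) (Nat.iter k' st (h x'))).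
    { intros x k x' k' H. specialize (Hh x' x k H). destruct k' as [|k']; [exact Hh|].
      apply lt_trans with (h x'); [exact Hh|]. apply (incr x' 0). lia. }
    intros x k x' k' H.
    destruct (lt_total x x') as [L|[->|L]].
    + exfalso. apply (incr' x k x' k') in L. rewrite H in L. exact (lt_irrefl _ L).
    + split; [reflexivity|]. destruct (Nat.lt_total k k') as [L|[L|L]]; [|assumption|];
        exfalso; apply (incr x') in L; rewrite H in L; exact (lt_irrefl _ L).
    + exfalso. apply (incr' x' k' x k) in L. rewrite H in L. exact (lt_irrefl _ L).
Qed.

End OmegaOne.

(** * Guessing sequences of sets *)

Lemma limit_points_club {T : Type} (lt : T -> T -> Prop) (C : T -> Prop)
    (f : nat -> T -> T) :
  is_omega1 lt -> club lt C ->
  exists D, club lt D /\ forall d, D d -> C d /\ (exists g, lt g d) /\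
    (forall g, lt g d -> exists x, lt g x /\ lt x d /\ C x) /\
    forall n x, lt x d -> lt (f n x) d.
Proof.
  intros omega1 [clC unC].
  (* On a one-element list, [true] asks for a point of [C] above the parameter and [false] for its
     image under [f n]. *)
  destruct (reflects_club lt omega1 (fun k n l x => Forall (fun g =>
    if k then lt g x /\ C x else x = f n g) l)) as (D & clubD & HD).
  exists D. split; [assumption|]. intros d Dd. destruct (HD d Dd) as [Hne Hd].
  assert (Hlim : forall g, lt g d -> exists x, lt g x /\ lt x d /\ C x).
  { intros g Hg. destruct (Hd true 0 [g]) as (x & H1 & H2); [auto| |].
    - destruct (unC g) as (x & Hx). exists x. auto.
    - inversion H2; subst. exists x. tauto. }
  repeat split; auto.
  intros n x Hx. destruct (Hd false n [x]) as (z & H1 & H2); [auto|now exists (f n x); auto|].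
  inversion H2; now subst.
Qed.

(** The sequence is coded as one subset of [T] through [pr]. Below a point closed under all maps
    [pr x n], a correct guess of the code decodes to a correct guess of every term. *)
Lemma diamond_sequences {T : Type} (lt : T -> T -> Prop) :
  is_omega1 lt -> diamond lt ->
  exists G : T -> nat -> T -> Prop, forall R : nat -> T -> Prop,
    stationary lt (fun b => forall n x, lt x b -> (R n x <-> G b n x)).
Proof.
  intros omega1 (A & _ & HA). destruct (pairing lt omega1) as [pr Hpr].
  exists (fun b n x => A b (pr x n)). intros R C clubC.
  destruct (limit_points_club lt C (fun n x => pr x n) omega1 clubC) as (D & clubD & HD).
  destruct (HA (fun z => exists n x, z = pr x n /\ R n x) D clubD) as (b & Db & Hb).
  destruct (HD b Db) as (Cb & _ & _ & Hcl).
  exists b. split; [assumption|]. intros n x Hx.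
  rewrite <- (Hb (pr x n) (Hcl n x Hx)). split.
  - intros H. now exists n, x.
  - intros (n' & x' & E & H). apply Hpr in E as [-> ->]. exact H.
Qed.

(** * The graph *)

Section Graph.
Context {T : Type} (lt : T -> T -> Prop).
Hypothesis omega1 : is_omega1 lt.
Context (t : T -> nat -> T) (guess : T -> nat -> T -> Prop) (s : nat -> nat).
Hypothesis t_incr : forall v i j, i < j -> lt (t v i) (t v j).

Let lt_irrefl : forall x, ~ lt x x := proj1 omega1.
Let lt_trans : forall x y z, lt x y -> lt y z -> lt x z := proj1 (proj2 omega1).
Let lt_wf : well_founded lt := proj1 (proj2 (proj2 (proj2 omega1))).

(** The first index of the [j]-th window, whose length is the one that
    [interleaved_no_short_odd_closed_walk] asks for. *)
Fixpoint window (j : nat) : nat :=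
  match j with
  | 0 => 0
  | S j => window j + 3 * (s j + 1) * (s j + 1)
  end.

Lemma window_mono i j : i <= j -> window i <= window j.
Proof. intros H. induction H; simpl; lia. Qed.

Definition matching (n : nat) (a b : T) : Prop :=
  forall j, j <= n -> interleaved lt t (s j) (window j) (window (S j)) a b.

(* [guess b 0] is the guessed club and [guess b (S n)] the guessed colour class
   of [n]. *)
Definition candidate (b : T) (n : nat) (a : T) : Prop :=
  lt (t b n) a /\ lt a b /\ (forall g, lt g b -> exists i, lt g (t b i)) /\
  guess b (S n) a /\ matching n a b.

Definition pick (b : T) (n : nat) : T :=
  epsilon (omega1_inhabited lt omega1) (candidate b n).

Definition edge (n : nat) (a b : T) : Prop := candidate b n a /\ a = pick b n.

Definition graph (x y : T) : Prop := exists n, edge n x y \/ edge n y x.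

Lemma edge_exists b n : (exists a, candidate b n a) -> exists a, edge n a b.
Proof.
  intros H. eexists. split; [|reflexivity].
  exact (epsilon_spec (omega1_inhabited lt omega1) _ H).
Qed.

Lemma edge_lt n a b : edge n a b -> lt a b.
Proof. intros [H _]. apply H. Qed.

Lemma graph_simple : simple_graph graph.
Proof.
  split.
  - intros x [n [H|H]]; exact (lt_irrefl _ (edge_lt _ _ _ H)).
  - intros x y [n H]. exists n. tauto.
Qed.

(** A type-[n] neighbour lies above [t b n], so one that is not above [t b i] has type less than
    [i]. Hence the smaller neighbours of [b] can accumulate only at [b]. *)
Lemma edge_index_bounded b i a n :
  ~ lt (t b i) a -> edge n a b -> In a (map (pick b) (seq 0 i)).
Proof.
  intros Hi [[H1 _] ->]. apply in_map, in_seq. split; [lia|].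
  destruct (le_lt_dec i n) as [H|H]; [|assumption]. exfalso. apply Hi.
  apply Nat.lt_eq_cases in H as [H| ->]; [|assumption]. eauto.
Qed.

Lemma graph_hajnal_mate : hajnal_mate lt graph.
Proof.
  split; [apply graph_simple|]. intros b.
  assert (down : forall a, lt a b -> graph a b -> exists n, edge n a b).
  { intros a Hab [n [H|H]]; [eauto|]. exfalso. apply (lt_irrefl a).
    eapply lt_trans; [exact Hab|exact (edge_lt _ _ _ H)]. }
  destruct (classic (finite_set (fun a => lt a b /\ graph a b))) as [F|F]; [now left|right].
  assert (cof : forall g, lt g b -> exists i, lt g (t b i)).
  { apply NNPP. intros H. apply F. exists []. intros x [Hx Hg].
    destruct (down x Hx Hg) as [n [(_ & _ & Hc & _) _]]. contradiction. }
  assert (fin : forall i, finite_set (fun a => lt a b /\ graph a b /\ ~ lt (t b i) a)).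
  { intros i. exists (map (pick b) (seq 0 i)). intros a (Hab & Hg & Hi).
    destruct (down a Hab Hg) as [n Hn]. now apply (edge_index_bounded b i a n). }
  repeat split.
  - tauto.
  - exact F.
  - intros x [Hx _]. destruct (cof x Hx) as [i Hi]. destruct (fin i) as [l Hl].
    exists l. intros y [[Hy Hg] Hyx]. apply Hl. repeat split; auto. intros H.
    apply (lt_irrefl y). eauto.
  - intros g Hg. destruct (cof g Hg) as [i Hi].
    apply NNPP. intros H. apply F. destruct (fin i) as [l Hl]. exists l.
    intros a [Ha Hga]. apply Hl. repeat split; auto. intros Hia. apply H.
    exists a. eauto.
Qed.

(** * Colouring finite subgraphs *)

Lemma low_edges_colorable (j : nat) : exists c : T -> nat,
  (forall x, c x <= j) /\ forall n x y, n < j -> edge n x y -> c x <> c y.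
Proof.
  destruct (well_founded_choice lt (fun b (c : T -> nat) v => v <= j /\
      forall n a, n < j -> edge n a b -> c a <> v)) as [c Hc].
  - exact lt_wf.
  - constructor; exact 0.
  - intros b c c' v Hcc [H1 H2]. split; [assumption|]. intros n a Hn He.
    rewrite <- Hcc; [eauto|]. exact (edge_lt _ _ _ He).
  - intros b c.
    set (used := map (fun n => c (pick b n)) (seq 0 j)).
    assert (exists v, In v (seq 0 (S j)) /\ ~ In v used) as (v & H1 & H2).
    { apply NNPP. intros H.
      assert (L : length (seq 0 (S j)) <= length used).
      { apply NoDup_incl_length; [apply seq_NoDup|]. intros v Hv.
        apply NNPP. intros Hn. eauto. }
      unfold used in L. rewrite length_map, !length_seq in L. lia. }
    exists v. apply in_seq in H1. split; [lia|]. intros n a Hn [_ ->] <-.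
    apply H2. apply in_map_iff. exists n. split; [reflexivity|]. apply in_seq; lia.
  - exists c. split; [intros x; apply Hc|]. intros n x y Hn He. eapply Hc; eauto.
Qed.

Lemma high_edges_bipartite (j : nat) (S : list T) : 2 * length S <= s j ->
  exists c : T -> bool, forall n x y, j <= n -> In x S -> In y S -> edge n x y -> c x <> c y.
Proof.
  intros HS.
  set (E := fun x y => interleaved lt t (s j) (window j) (window (Datatypes.S j)) x y \/
    interleaved lt t (s j) (window j) (window (Datatypes.S j)) y x).
  destruct (bipartite_of_no_short_odd_closed_walk E S) as [c Hc].
  - unfold E; tauto.
  - intros x n Hn Hlt. apply interleaved_no_short_odd_closed_walk; auto. lia.
  - exists c. intros n x y Hn xS yS [(_ & _ & _ & _ & He) _].
    apply Hc; auto. left. now apply He.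
Qed.

Lemma graph_finite_colorable (j : nat) (S : list T) : 2 * length S <= s j ->
  colorable_on graph S (2 * (j + 1)).
Proof.
  intros HS. destruct (low_edges_colorable j) as (c1 & B1 & H1).
  destruct (high_edges_bipartite j S HS) as (c2 & H2).
  (* The product colouring: the pair of [c1 x] and the bit [c2 x], coded as one number. *)
  exists (fun x => 2 * c1 x + Nat.b2n (c2 x)). split.
  - intros x _. specialize (B1 x). destruct (c2 x); simpl; lia.
  - assert (He : forall n x y, In x S -> In y S -> edge n x y ->
        2 * c1 x + Nat.b2n (c2 x) <> 2 * c1 y + Nat.b2n (c2 y)).
    { intros n x y xS yS Hxy. destruct (le_lt_dec j n) as [L|L].
      - specialize (H2 n x y L xS yS Hxy). destruct (c2 x), (c2 y); simpl; try lia; easy.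
      - specialize (H1 n x y L Hxy). destruct (c2 x), (c2 y); simpl; lia. }
    intros x y xS yS [n [H|H]]; [eauto|]. apply not_eq_sym. eauto.
Qed.

(** * Placing the entries of one sequence in the gaps of another *)

Lemma placement_exists : exists lam : nat -> nat,
  (forall i m, i <= m -> lam i <= lam m) /\
  forall j i, window j <= i -> i + s j + 1 < window (S j) ->
    lam (i + s j) <= i /\ i < lam (i + s j + 1).
Proof.
  assert (win : forall m, exists j, window j <= m < window (S j)).
  { induction m as [|m [j Hj]]; [exists 0; simpl; nia|].
    destruct (le_lt_dec (window (S j)) (S m)) as [H|H].
    - exists (S j). split; [assumption|]. change (window (S (S j))) with
        (window (S j) + 3 * (s (S j) + 1) * (s (S j) + 1)). nia.
    - exists j. lia. }
  destruct (functional_choice _ win) as [w Hw].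
  assert (uniq : forall m j, window j <= m < window (S j) -> w m = j).
  { intros m j Hj. specialize (Hw m).
    destruct (Nat.lt_total (w m) j) as [L|[L|L]]; [|assumption|];
      apply window_mono in L; lia. }
  (* Entry [m] of the lower sequence is to lie below entry [lam m] of the upper one and above all
     earlier ones. The shift demands [m - s j] in window [j]; cutting off at the start of the window
     keeps [lam] monotone from one window to the next. *)
  exists (fun m => Nat.max (window (w m)) (m - s (w m))). split.
  - intros i m H. induction H as [|m H IH]; [lia|].
    etransitivity; [exact IH|]. assert (A := Hw m). assert (B := Hw (S m)).
    destruct (Nat.lt_total (w m) (w (S m))) as [L|[L|L]].
    + apply window_mono in L. lia.
    + rewrite <- L. lia.
    + apply window_mono in L. lia.
  - intros j i H1 H2. rewrite (uniq (i + s j) j), (uniq (i + s j + 1) j) by lia. lia.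
Qed.

(** * A game that builds the prefix of a sequence *)

Section Game.
Context (N : nat) (col : T -> Prop).

Definition prefix (y : nat -> T) (m : nat) : list T := map y (seq 0 m).

(** Here [l] is the part of the prefix already played, [x] the next move and [k] the number of moves
    after it. The last move is a vertex in [col] whose first [N] entries are the moves before. *)
Fixpoint wins (k : nat) (l : list T) (x : T) : Prop :=
  match k with
  | 0 => col x /\ prefix (t x) N = l
  | S k => forall g, exists y, lt g y /\ wins k (l ++ [x]) y
  end.

(* Each of the remaining [k] entries of the prefix of [t a], and then [a]
   itself, can be chosen unboundedly often. *)
Definition good (k : nat) (l : list T) : Prop := forall g, exists y, lt g y /\ wins k l y.

(** Used contrapositively: if [d] itself is a winning move after some [l] below [d], then the
    winning moves after [l] are unbounded. *)
Definition bounds_reflect (d : T) : Prop :=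
  forall l, Forall (fun x => lt x d) l ->
    (exists g, forall x, lt g x -> ~ wins (N - length l) l x) ->
    exists g, lt g d /\ forall x, lt g x -> ~ wins (N - length l) l x.

Definition wins_reflect (d : T) : Prop :=
  forall g l, lt g d -> Forall (fun x => lt x d) l ->
    (exists x, lt g x /\ wins (N - length l) l x) ->
    exists x, lt x d /\ lt g x /\ wins (N - length l) l x.

Lemma prefix_S y m : prefix y (S m) = prefix y m ++ [y m].
Proof. unfold prefix. now rewrite seq_S, map_app. Qed.

Lemma length_prefix y m : length (prefix y m) = m.
Proof. unfold prefix. now rewrite length_map, length_seq. Qed.

(** The entries of [t b] followed by [b] are a winning play. Going backwards from [b], reflection at
    each move turns this single winning move into unboundedly many. *)
Lemma good_of_reflection b : col b ->
  (forall i, bounds_reflect (t b i)) -> bounds_reflect b ->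
  (forall i, lt (t b i) b) ->
  good N [].
Proof.
  intros Hcol Rt Rb Hb.
  assert (step : forall k d, k <= N -> bounds_reflect d ->
      Forall (fun x => lt x d) (prefix (t b) (N - k)) ->
      wins k (prefix (t b) (N - k)) d -> good k (prefix (t b) (N - k))).
  { intros k d Hk Rd Hl Hw. apply NNPP. intros Hg.
    assert (E : N - length (prefix (t b) (N - k)) = k) by (rewrite length_prefix; lia).
    destruct (Rd _ Hl) as (g & H1 & H2).
    - rewrite E. apply not_all_ex_not in Hg as [g Hg]. exists g.
      intros x Hx Hwx. eauto.
    - rewrite E in H2. exact (H2 d H1 Hw). }
  assert (all : forall k, k <= N -> good k (prefix (t b) (N - k))).
  { induction k as [|k IH]; intros Hk.
    - apply (step 0 b); auto.
      + apply Forall_forall. intros x Hx. apply in_map_iff in Hx as (i & <- & _). auto.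
      + split; [assumption|]. now rewrite Nat.sub_0_r.
    - apply (step (S k) (t b (N - S k))); auto.
      + apply Forall_forall. intros x Hx. apply in_map_iff in Hx as (i & <- & Hi).
        apply in_seq in Hi. apply t_incr. lia.
      + simpl. rewrite <- prefix_S. replace (S (N - S k)) with (N - k) by lia.
        apply IH. lia. }
  specialize (all N (Nat.le_refl N)). now rewrite Nat.sub_diag in all.
Qed.

(** In a good position there are winning moves above any bound, and reflection at [y (lam m)] brings
    one down into the required gap. Monotonicity of [lam] keeps the earlier moves below [y (lam m)],
    so they are admissible parameters. *)
Lemma good_place (y : nat -> T) (lam : nat -> nat) (dflt : T) :
  (forall i j, i < j -> lt (y i) (y j)) ->
  (forall i m, i <= m -> lam i <= lam m) ->
  (exists g, lt g (y 0)) ->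
  (forall i, wins_reflect (y i)) ->
  good N [] ->
  forall m, m <= N -> exists l, length l = m /\ good (N - m) l /\
    forall i, i < m -> lt (nth i l dflt) (y (lam i)) /\
      forall k, k < lam i -> lt (y k) (nth i l dflt).
Proof.
  intros yincr lmono [g0 Hg0] Ry Hgood. induction m as [|m IH]; intros Hm.
  - exists []. repeat split; [now rewrite Nat.sub_0_r| |]; lia.
  - destruct IH as (l & Hl & Gl & Pl); [lia|].
    assert (exists g, lt g (y (lam m)) /\ forall k, k < lam m -> le lt (y k) g)
      as (g & Hg & Hgk).
    (* [g] is the lower end of the gap; if [lam m] is [0], the point [g0] below [y 0] serves. *)
    { destruct (lam m) as [|p]; [exists g0; split; [assumption|lia]|].
      exists (y p). split; [apply yincr; lia|]. intros k Hk.
      destruct (Nat.eq_dec k p) as [->|]; [now right|left; apply yincr; lia]. }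
    destruct (Ry (lam m) g l Hg) as (x & Hx & Hgx & Hw).
    + apply Forall_forall. intros z Hz. destruct (In_nth _ _ dflt Hz) as (i & Hi & <-).
      rewrite Hl in Hi. destruct (Pl i Hi) as [H _].
      assert (L := lmono i m (Nat.lt_le_incl _ _ Hi)).
      apply Nat.lt_eq_cases in L as [L|<-]; eauto.
    + rewrite Hl. apply Gl.
    + exists (l ++ [x]). rewrite Hl in Hw. repeat split.
      * rewrite length_app; simpl; lia.
      * replace (N - m) with (S (N - S m)) in Hw by lia. exact Hw.
      * destruct (Nat.eq_dec i m) as [->|]; [rewrite app_nth2, Hl, Nat.sub_diag by lia; exact Hx|].
        rewrite app_nth1 by lia. apply Pl. lia.
      * intros k Hk. destruct (Nat.eq_dec i m) as [->|].
        -- rewrite app_nth2, Hl, Nat.sub_diag by lia. simpl.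
           eapply le_lt_trans; eauto.
        -- rewrite app_nth1 by lia. apply Pl; [lia|assumption].
Qed.

End Game.

Lemma nth_prefix y m i d : i < m -> nth i (prefix y m) d = y i.
Proof.
  intros H. unfold prefix. rewrite (nth_indep _ d (y 0)) by now rewrite length_map, length_seq.
  now rewrite map_nth, seq_nth.
Qed.

(** * Uncountable chromatic number *)

Hypothesis t_club : forall b, (exists g, lt g b) ->
  (forall g, lt g b -> exists x, lt g x /\ lt x b /\ guess b 0 x) ->
  (forall i, lt (t b i) b /\ guess b 0 (t b i)) /\ forall g, lt g b -> exists i, lt g (t b i).

Hypothesis guessing : forall R : nat -> T -> Prop,
  stationary lt (fun b => forall n x, lt x b -> (R n x <-> guess b n x)).

Lemma matching_exists (n : nat) (col : T -> Prop) (b : T) :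
  col b ->
  (forall i, lt (t b i) b) -> (exists g, lt g (t b 0)) ->
  (forall d, d = b \/ (exists i, d = t b i) ->
    bounds_reflect (window (S n)) col d /\ wins_reflect (window (S n)) col d) ->
  exists a, lt (t b n) a /\ lt a b /\ col a /\ matching n a b.
Proof.
  intros Hcol Hb H0 R. destruct placement_exists as (lam & lmono & Hlam).
  assert (G : good (window (S n)) col (window (S n)) []).
  { apply (good_of_reflection _ _ b); auto; intros; apply R; eauto. }
  destruct (good_place (window (S n)) col (t b) lam b) with (m := window (S n))
    as (l & Hl & Gl & Pl); auto.
  { intros i. apply R; eauto. }
  rewrite Nat.sub_diag in Gl.
  (* All entries are placed; the last move is the vertex [a] itself, reflected to between [t b n]
     and [b]. *)
  destruct (proj2 (R b (or_introl eq_refl)) (t b n) l) as (a & Hab & Hna & Hw).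
  - apply Hb.
  - apply Forall_forall. intros z Hz. destruct (In_nth _ _ b Hz) as (i & Hi & <-).
    rewrite Hl in Hi. apply Pl in Hi as [Hi _]. eauto.
  - rewrite Hl, Nat.sub_diag. apply Gl.
  - rewrite Hl, Nat.sub_diag in Hw. destruct Hw as [Ha <-].
    exists a. repeat split; auto; intros.
    all: assert (L : window (S j) <= window (S n)) by (apply window_mono; lia).
    all: destruct (Hlam j i) as [L1 L2]; auto.
    + destruct (Pl (i + s j)) as [H3 _]; [lia|]. rewrite nth_prefix in H3 by lia.
      apply Nat.lt_eq_cases in L1 as [L1|L1]; [eauto|now rewrite L1 in H3].
    + destruct (Pl (i + s j + 1)) as [_ H3]; [lia|]. rewrite nth_prefix in H3 by lia. auto.
Qed.

Lemma graph_chromatic : chromatic_aleph1 graph.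
Proof.
  intros [c Hc].
  set (W := fun n l => wins (window (S n)) (fun a => c a = n) (window (S n) - length l) l).
  (* One club for all colours: [true] yields [wins_reflect], the head of the list being the lower
     bound, and [false] yields [bounds_reflect]. *)
  destruct (reflects_club lt omega1 (fun k n l x =>
    if k then match l with g :: l => lt g x /\ W n l x | [] => False end
    else forall y, lt x y -> ~ W n l y)) as (D & clubD & HD).
  destruct (limit_points_club lt D (fun _ x => x) omega1 clubD) as (C & clubC & HC).
  destruct (guessing (fun n x => match n with 0 => D x | S n => c x = n end) C clubC)
    as (b & Cb & Hb).
  destruct (HC b Cb) as (Db & Hne & Hlim & _).
  destruct (t_club b Hne) as [Ht Hcof].
  { intros g Hg. destruct (Hlim g Hg) as (x & H1 & H2 & H3). exists x.
    repeat split; auto. now apply (Hb 0 x). }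
  assert (tD : forall i, D (t b i)) by (intros i; apply (Hb 0); apply Ht).
  destruct (matching_exists (c b) (fun a => c a = c b) b) as (a & H1 & H2 & H3 & H4).
  - reflexivity.
  - intros i. apply Ht.
  - apply (HD _ (tD 0)).
  - intros d Hd.
    assert (Dd : D d) by (destruct Hd as [->|[i ->]]; auto).
    destruct (HD d Dd) as [_ Rd]. split.
    + intros l Hl Hex. exact (Rd false (c b) l Hl Hex).
    + intros g l Hg Hl Hex. apply (Rd true (c b) (g :: l)); auto.
  (* The picked neighbour [a'] may differ from [a], but as a candidate it lies in the guessed class,
     and the guess at [b] is correct. *)
  - destruct (edge_exists b (c b)) as [a' Ha'].
    + exists a. repeat split; auto; [|intros; now apply H4..].
      now apply (Hb (S (c b)) a).
    + apply (Hc a' b); [exists (c b); now left|].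
      destruct Ha' as [(_ & Hlt & _ & Hg & _) _]. now apply (Hb (S (c b)) a').
Qed.

End Graph.

(** * Choice of the sequences and of the shifts *)

Lemma list_sum_ge (l : list nat) (n : nat) : In n l -> n <= list_sum l.
Proof. induction l as [|m l IH]; simpl; [easy|]. intros [->|H]; [lia|]. specialize (IH H). lia. Qed.

Lemma ladder_exists {T : Type} (lt : T -> T -> Prop) (D : T -> T -> Prop) :
  is_omega1 lt ->
  exists t : T -> nat -> T, (forall v i j, i < j -> lt (t v i) (t v j)) /\
    forall b, (exists g, lt g b) ->
      (forall g, lt g b -> exists x, lt g x /\ lt x b /\ D b x) ->
      (forall i, lt (t b i) b /\ D b (t b i)) /\
      forall g, lt g b -> exists i, lt g (t b i).
Proof.
  intros omega1.
  destruct (functional_choice (fun b (y : nat -> T) =>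
      (forall i j, i < j -> lt (y i) (y j)) /\
      ((exists g, lt g b) ->
       (forall g, lt g b -> exists x, lt g x /\ lt x b /\ D b x) ->
       (forall i, lt (y i) b /\ D b (y i)) /\ forall g, lt g b -> exists i, lt g (y i))))
    as [t Ht].
  - intros b.
    destruct (classic ((exists g, lt g b) /\
      forall g, lt g b -> exists x, lt g x /\ lt x b /\ D b x)) as [[H1 H2]|H].
    + destruct (cofinal_sequence lt omega1 b (D b) H1 H2) as (y & Hy & Hy').
      exists y. auto.
    + destruct (functional_choice _ (exists_gt lt omega1)) as [st Hst].
      (* Where [D b] is not cofinal in [b], any increasing sequence will do. *)
      exists (fun n => Nat.iter n st b). split; [|tauto].
      apply (increasing_of_step lt omega1 (fun n => Nat.iter n st b)).
      intros n. apply Hst.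
  - exists t. split; intros b; apply (Ht b).
Qed.

Theorem theoremB :
  forall (T : Type) (lt : T -> T -> Prop),
    is_omega1 lt ->
    diamond lt ->
    forall f : nat -> nat,
      exists E : T -> T -> Prop,
        hajnal_mate lt E /\
        chromatic_aleph1 E /\
        forall k : nat, 3 <= k ->
          forall S : list T, NoDup S -> length S < f k ->
            colorable_on E S (k - 1).
Proof.
  intros T lt omega1 dia f.
  destruct (diamond_sequences lt omega1 dia) as [guess Hguess].
  destruct (ladder_exists lt (fun b => guess b 0) omega1) as (t & Hincr & Hclub).
  (* With [j = (k - 3) / 2], [k] is [2 * j + 3] or [2 * j + 4]. So [f k] is a term of the sum, and
     the [2 * (j + 1)] colours number at most [k - 1]. *)
  set (s := fun j => 2 * list_sum (map f (seq 0 (2 * j + 5)))).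
  exists (graph lt omega1 t guess s). split; [|split].
  - now apply graph_hajnal_mate.
  - now apply graph_chromatic.
  - intros k Hk S _ HS.
    assert (Hj := Nat.div_mod_eq (k - 3) 2).
    assert (Hr := Nat.mod_upper_bound (k - 3) 2 ltac:(lia)).
    set (j := (k - 3) / 2) in *.
    destruct (graph_finite_colorable lt omega1 t guess s Hincr j S) as (c & B & Hc).
    + unfold s. assert (f k <= list_sum (map f (seq 0 (2 * j + 5)))); [|lia].
      apply list_sum_ge, in_map, in_seq. lia.
    + exists c. split; [|assumption]. intros x Hx. specialize (B x Hx). lia.
Qed.
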